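(* Consider the noisy corruption detection game on a graph $G$ with noise parameter $\epsilon$. If $G$ is a constant-degree graph, $|V(G)|=n$, the sets $T$ of truthful vertices and $B$ of corrupt vertices satisfy $|T|-|B|\le n^{1/2-\beta}$ for an arbitrary fixed $\beta>0$, and the player only makes $o(n\log n)$ queries, then there exists a strategy for the corrupt vertices so that any strategy the player uses to find $T'$ with $|T\,\Delta\,T'|\le \frac{n}{10}$ will succeed with probability at most $\frac12+o(1)$.
   Context: Noisy corruption detection game with noise parameter $\epsilon$: a finite simple connected graph $G$ on $n$ vertices is given, and $V(G)=T\sqcup B$ is a partition, unknown to the player, into truthful vertices $T$ and corrupt vertices $B$. In a query, the player asks a vertex $u$ whether its neighbor $v$ is truthful or corrupt; the same vertex $u$ may be asked about the same neighbor $v$ many times and may answer differently each time. Each time a truthful vertex is queried, it answers correctly with probability $1-\epsilon$, independently over queries. Corrupt vertices answer adversarially, according to a strategy of their choosing. Here $\epsilon>0$ is a fixed constant, and the degree of $G$ is also considered a constant. $T\,\Delta\,T'$ denotes the symmetric difference, where $T'\subseteq V(G)$ is the set output by the player. $o(1)$ denotes a quantity that tends to $0$ as $n\to\infty$.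
   Formalization: Adds |T| > n/10, since for |T| ≤ n/10 the player always succeeds by outputting the empty set; takes 0<ε<1; and the corrupt side's strategy includes a random choice of the partition T, B with the prescribed sizes, since a T known in advance could simply be output. *)

(* Defs.v *)
From HB Require Import structures.
From mathcomp Require Import all_boot all_order all_algebra.
From mathcomp Require Import all_classical all_reals all_analysis.
Set Implicit Arguments.
Unset Strict Implicit.
Unset Printing Implicit Defensive.
Import Order.TTheory GRing.Theory Num.Theory.
Import numFieldNormedType.Exports.
Local Open Scope ring_scope.

Record distr (R : realType) (A : finType) := Distr {
  mass :> A -> R;
  mass_ge0 : forall a, 0 <= mass a;
  mass_sum1 : \sum_a mass a = 1
}.

Definition simple_graph (V : finType) (e : rel V) : Prop :=
  symmetric e /\ irreflexive e.

Definition connected_graph (V : finType) (e : rel V) : Prop :=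
  forall x y : V, connect e x y.

Definition max_degree_le (V : finType) (e : rel V) (d : nat) : Prop :=
  forall x : V, (#|[set y | e x y]| <= d)%N.

Definition symdiff (V : finType) (A B : {set V}) : {set V} :=
  (A :\: B) :|: (B :\: A).

Section Game.
Variables (R : realType) (V : finType) (e : rel V).

(* The query (u, v) asks u whether its neighbor v is truthful or corrupt. *)
Definition query : finType := {q : V * V | e q.1 q.2}.
Definition asked (q : query) : V := (val q).1.
Definition subject (q : query) : V := (val q).2.

(* Chronological list of queries with their answers; the answer [true] to
   (u, v) means "v is truthful". *)
Definition history := seq (query * bool).

(* At each history the player draws a move: [inl q] makes the query q, and
   [inr T'] stops and outputs T'.  As the player recalls the whole history, any
   randomized adaptive strategy induces the same law of play as one of these. *)
Definition player := history -> distr R (query + {set V})%type.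

Definition at_most_queries (pl : player) (k : nat) : Prop :=
  forall (h : history) (q : query), (k <= size h)%N -> pl h (inl q) = 0.

(* The corrupt vertices hide in the graph, possibly at random: [placement] is
   the law of the set T of truthful vertices.  Knowing T and the past, they
   answer the current query (when a corrupt vertex is asked) according to
   [reply]. *)
Record corrupt_strategy := CorruptStrategy {
  placement : distr R {set V};
  reply : {set V} -> history -> query -> distr R bool
}.

Definition places_truthful (cs : corrupt_strategy) (t : nat) : Prop :=
  forall T : {set V}, placement cs T != 0 -> #|T| = t.

Section Play.
Variables (eps : R) (cs : corrupt_strategy) (pl : player) (T : {set V}).

(* Probability, given the truthful set T and the past h, that q is answered
   by b. *)
Definition answer_prob (h : history) (q : query) (b : bool) : R :=
  if asked q \in T then
    (if b == (subject q \in T) then 1 - eps else eps)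
  else reply cs T h q b.

(* Probability, given T and the past h, that the player outputs T' after at
   most k further queries. *)
Fixpoint output_prob (k : nat) (h : history) (T' : {set V}) : R :=
  pl h (inr T') +
  (if k is k'.+1 then
     \sum_(q : query) pl h (inl q) *
       \sum_(b : bool) answer_prob h q b * output_prob k' (rcons h (q, b)) T'
   else 0).

End Play.

(* Probability that a player making at most k queries outputs some T' with
   |T Delta T'| <= n / 10. *)
Definition success_prob (eps : R) (k : nat) (cs : corrupt_strategy)
    (pl : player) : R :=
  \sum_(T : {set V}) placement cs T *
    \sum_(T' : {set V} | #|symdiff T T'|%:R <= #|V|%:R / 10 :> R)
      output_prob eps cs pl T k [::] T'.

End Game.

(* Main.v *)
(** The corrupt vertices answer as the truthful ones would if the two sides were
exchanged, so that the law of an answer depends only on the partition {T, B}.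
If |T| <= |B|, as many corrupt vertices as there are truthful ones form such a
mirror image, the game is exactly symmetric, and no output is close to both sides.

If |T| - |B| = s > 0, fix T outside an independent set F of m >= n / (2(d + 1))
vertices and let S = T :&: F be random.  Compare S uniform of size m/2 with the
mirrored world, in which the complement of T meets F in a uniform set of size
m/2 - s.  It suffices that the law of play hardly changes between |S| = j and
|S| = j + 1.  Given the answers, the posterior of S under the uniform prior is a
product measure with marginals p_i, as F is independent.  Moving one vertex out
of S shows that the total mass of X = sum_(i in S) (1 - p_i) on |S| = j + 1
equals that of Y = sum_(i notin S) p_i on |S| = j; both X and Y have mean
v = sum_i p_i (1 - p_i) and deviations O(sqrt m), while o(n log n) queries leave
v >= m n^(-o(1)).  So each step costs n^(-1/2 + o(1)), and the s <= n^(1/2 - beta)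
steps together cost o(1). *)
Require Import Defs.
From HB Require Import structures.
From mathcomp Require Import all_boot all_order all_algebra.
From mathcomp Require Import all_classical all_reals all_analysis.
From mathcomp Require Import ring lra zify.
Import Order.TTheory GRing.Theory Num.Theory.
Import numFieldNormedType.Exports.
Local Open Scope ring_scope.

(** * Product measures on subsets: exponential moments and the comparison of adjacent layers *)

Section ProductMeasure.
Variables (R : realType) (I : finType) (p : I -> R).
Hypothesis p01 : forall i, 0 <= p i <= 1.

Definition prod_pmf (S : {set I}) : R :=
  \prod_i (if i \in S then p i else 1 - p i).

Lemma prod_pmf_ge0 S : 0 <= prod_pmf S.
Proof.
apply: prodr_ge0 => i _; have /andP[p0 p1] := p01 i.
by case: ifP => // _; rewrite subr_ge0.
Qed.

Lemma prod_pmf_sum1 : \sum_S prod_pmf S = 1.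
Proof.
have <- : \prod_i (p i + (1 - p i)) = 1.
  by rewrite big1 // => i _; rewrite addrC subrK.
by rewrite bigA_distr.
Qed.

(* Moving i out of S exchanges the factor p i for 1 - p i. *)
Lemma prod_pmf_exchange (j : nat) :
  \sum_(S : {set I} | #|S| == j.+1) prod_pmf S * \sum_(i in S) (1 - p i) =
  \sum_(S : {set I} | #|S| == j) prod_pmf S * \sum_(i | i \notin S) p i.
Proof.
under eq_bigr do rewrite mulr_sumr.
under [RHS]eq_bigr do rewrite mulr_sumr.
rewrite (exchange_big_dep xpredT) //= [RHS](exchange_big_dep xpredT) //=.
apply: eq_bigr => i _.
rewrite [RHS](reindex_onto (fun S => S :\ i) (fun S => i |: S)) /=; last first.
  by move=> S /andP[_ iS]; rewrite finset.setU1K.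
apply: eq_big => [S|S /andP[_ iS]].
  rewrite finset.setD11 andbT.
  have [iS|iS] := boolP (i \in S).
    by rewrite (cardsD1 i S) iS add1n eqSS finset.setD1K // eqxx !andbT.
  rewrite andbF; apply/esym/negbTE/negP => /andP[_ /eqP E].
  by move: iS; rewrite -E finset.setU11.
rewrite /prod_pmf (bigD1 i) //= iS [in RHS](bigD1 i) //= finset.setD11.
rewrite mulrAC [RHS]mulrAC [(1 - p i) * p i]mulrC; congr (_ * _).
by apply: eq_bigr => k ki; rewrite finset.in_setD1 ki.
Qed.

(** Inverting [1 - y <= expR (- y)] gives [expR y <= (1 - y)^-1], and
    [(1 + y + 2 * y ^+ 2) * (1 - y)] exceeds 1 by [y ^+ 2 * (1 - 2 * y)]. *)
Lemma expR_le_quad (y : R) : `|y| <= 1 / 2 -> expR y <= 1 + y + 2 * y ^+ 2.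
Proof.
rewrite ler_norml => /andP[y0 y1].
have h : 1 - y <= expR (- y) by have := expR_ge1Dx (- y).
have h1 : 0 < 1 - y by lra.
rewrite -[expR y]invrK -expRN.
apply: (@le_trans _ _ (1 - y)^-1); first by rewrite lef_pV2 ?posrE ?expR_gt0.
rewrite -div1r ler_pdivrMr //.
have : 0 <= y ^+ 2 * (1 - 2 * y).
  by apply: mulr_ge0; [apply: sqr_ge0 | lra].
by rewrite !expr2; nra.
Qed.

(** In the quadratic bounds of both exponentials the linear terms cancel by centring, leaving
    [1 + 2 * t ^+ 2 * (q * (1 - q))]. *)
Lemma bernoulli_mgf (q t : R) : 0 <= q <= 1 -> `|t| <= 1 / 2 ->
  q * expR (t * (1 - q)) + (1 - q) * expR (- (t * q)) <= expR (2 * t ^+ 2).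
Proof.
move=> /andP[q0 q1] ht.
have h (c : R) : 0 <= c <= 1 -> `|t * c| <= 1 / 2.
  move=> /andP[c0 c1]; rewrite normrM (ger0_norm c0).
  by apply: le_trans ht; rewrite ler_piMr.
have h1 : expR (t * (1 - q)) <= 1 + t * (1 - q) + 2 * (t * (1 - q)) ^+ 2.
  by apply/expR_le_quad/h; lra.
have h2 : expR (- (t * q)) <= 1 + - (t * q) + 2 * (- (t * q)) ^+ 2.
  by apply: expR_le_quad; rewrite normrN; apply: h; lra.
apply: le_trans (expR_ge1Dx _).
apply: (@le_trans _ _ (q * (1 + t * (1 - q) + 2 * (t * (1 - q)) ^+ 2) +
  (1 - q) * (1 + - (t * q) + 2 * (- (t * q)) ^+ 2))).
  by apply: lerD; apply: ler_wpM2l => //; lra.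
have -> : q * (1 + t * (1 - q) + 2 * (t * (1 - q)) ^+ 2) +
  (1 - q) * (1 + - (t * q) + 2 * (- (t * q)) ^+ 2) =
  1 + 2 * t ^+ 2 * (q * (1 - q)) by ring.
rewrite lerD2l ler_piMr //; first by rewrite mulr_ge0 ?sqr_ge0.
by nra.
Qed.

Lemma prod_pmf_mgf (t : I -> R) : (forall i, `|t i| <= 1 / 2) ->
  \sum_S prod_pmf S * expR (\sum_i t i * ((i \in S)%:R - p i)) <=
  expR (\sum_i 2 * t i ^+ 2).
Proof.
move=> ht.
have -> : \sum_S prod_pmf S * expR (\sum_i t i * ((i \in S)%:R - p i)) =
    \sum_(S : {set I}) \prod_i (if i \in S then p i * expR (t i * (1 - p i))
                              else (1 - p i) * expR (- (t i * p i))).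
  apply: eq_bigr => S _; rewrite expR_sum -big_split /=.
  by apply: eq_bigr => i _; case: (i \in S); rewrite /= ?mulr0n ?sub0r ?mulrN.
rewrite -bigA_distr expR_sum.
apply: ler_prod => i _; have /andP[p0 p1] := p01 i.
rewrite bernoulli_mgf ?p01 // andbT.
by rewrite addr_ge0 // mulr_ge0 ?expR_ge0 ?subr_ge0.
Qed.

(** The exponential of [|Z|] is at most the sum of those of [Z] and [- Z]. The bound [2 <= sg] keeps
    every coefficient within 1/2, and [2 * #|I|%:R <= sg ^+ 2] keeps the resulting exponent at most
    1. *)
Lemma prod_pmf_abs_mgf (w : I -> R) (sg : R) :
    (forall i, 0 <= w i <= 1) -> 2 <= sg -> 2 * #|I|%:R <= sg ^+ 2 ->
  \sum_S prod_pmf S * expR (`|\sum_i w i * ((i \in S)%:R - p i)| / sg) <=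
  2 * expR 1.
Proof.
move=> w01 sg2 hsg; have sg0 : 0 < sg by lra.
have bound (c : R) : `|c| = 1 ->
    \sum_S prod_pmf S * expR (\sum_i (c * w i / sg) * ((i \in S)%:R - p i)) <=
    expR 1.
  move=> c1; apply: le_trans (prod_pmf_mgf _ _) _.
    move=> i; have /andP[w0 w1] := w01 i.
    rewrite !normrM c1 (mul1r `|w i|) normfV (gtr0_norm sg0) (ger0_norm w0).
    by rewrite ler_pdivrMr //; lra.
  rewrite ler_expR.
  apply: (@le_trans _ _ (\sum_(i : I) 2 / sg ^+ 2)).
    apply: ler_sum => i _; rewrite ler_wpM2l // !exprMn.
    have -> : c ^+ 2 = 1 by rewrite -real_normK ?num_real// c1 expr1n.
    rewrite mul1r exprVn ler_piMl ?invr_ge0 ?sqr_ge0 //.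
    by have /andP[w0 w1] := w01 i; rewrite expr2; nra.
  rewrite sumr_const -[_ *+ _]mulr_natr mulrAC ler_pdivrMr ?exprn_gt0 // mul1r.
  exact: hsg.
have -> : 2 * expR 1 = expR 1 + expR 1 :> R by ring.
apply: le_trans (lerD (bound 1 (normr1 _)) (bound (-1) (normrN1 _))).
rewrite -big_split /=; apply: ler_sum => S _.
rewrite -mulrDr ler_wpM2l ?prod_pmf_ge0 //.
have Ec (c : R) : \sum_i c * w i / sg * ((i \in S)%:R - p i) =
    c * (\sum_i w i * ((i \in S)%:R - p i)) / sg.
  by rewrite mulr_sumr mulr_suml; apply: eq_bigr => i _; ring.
rewrite !Ec mul1r mulN1r; set Z := \sum_i _.
have [Z0|Z0] := leP 0 Z.
  by rewrite ger0_norm // lerDl expR_ge0.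
by rewrite ltr0_norm // lerDr expR_ge0.
Qed.

(* |Z| <= sg (A + exp (|Z| / sg - A)) turns the exponential moment into a first
   moment restricted to the sets in Q. *)
Lemma prod_pmf_dev (Q : pred {set I}) (w : I -> R) (sg A : R) :
    (forall i, 0 <= w i <= 1) -> 2 <= sg -> 2 * #|I|%:R <= sg ^+ 2 ->
  \sum_(S | Q S) prod_pmf S * `|\sum_i w i * ((i \in S)%:R - p i)| <=
  sg * (A * \sum_(S | Q S) prod_pmf S + 2 * expR 1 * expR (- A)).
Proof.
move=> w01 sg2 hsg; have sg0 : 0 < sg by lra.
pose Z (S : {set I}) := `|\sum_i w i * ((i \in S)%:R - p i)|.
apply: (@le_trans _ _ (\sum_(S | Q S)
    (sg * A * prod_pmf S + sg * expR (- A) * (prod_pmf S * expR (Z S / sg))))).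
  apply: ler_sum => S _.
  have -> : sg * A * prod_pmf S +
      sg * expR (- A) * (prod_pmf S * expR (Z S / sg)) =
      prod_pmf S * (sg * (A + expR (Z S / sg - A))).
    by rewrite expRD; ring.
  rewrite ler_wpM2l ?prod_pmf_ge0 // -/(Z S) -ler_pdivrMl // [_^-1 * _]mulrC.
  by have := expR_ge1Dx (Z S / sg - A); lra.
rewrite big_split /= -!mulr_sumr.
have -> : sg * (A * \sum_(S | Q S) prod_pmf S + 2 * expR 1 * expR (- A)) =
  sg * A * \sum_(S | Q S) prod_pmf S + sg * expR (- A) * (2 * expR 1) by ring.
rewrite lerD2l ler_wpM2l ?mulr_ge0 ?expR_ge0 ?(ltW sg0) //.
apply: le_trans (prod_pmf_abs_mgf w _ w01 sg2 hsg).
rewrite big_mkcond /=; apply: ler_sum => S _.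
by case: ifP => // _; rewrite mulr_ge0 ?prod_pmf_ge0 ?expR_ge0.
Qed.

(** The sums with weights [1 - p i] over S and [p i] outside S have the same mean v, up to sign the
    same kind of centred sum. [prod_pmf_dev] bounds how far each is from v on its own layer. *)
Lemma prod_pmf_step (j : nat) (sg A v0 : R) :
    2 <= sg -> 2 * #|I|%:R <= sg ^+ 2 -> 0 <= A ->
    0 < v0 -> v0 <= \sum_i p i * (1 - p i) ->
  `|\sum_(S : {set I} | #|S| == j.+1) prod_pmf S -
    \sum_(S : {set I} | #|S| == j) prod_pmf S| <=
  sg / v0 * (A * (\sum_(S : {set I} | #|S| == j.+1) prod_pmf S +
                  \sum_(S : {set I} | #|S| == j) prod_pmf S) +
             4 * expR 1 * expR (- A)).
Proof.
move=> sg2 hsg A0 v00 hv.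
set v := \sum_i _ in hv; have v_gt0 : 0 < v by apply: lt_le_trans hv.
have w1 i : 0 <= 1 - p i <= 1 by have := p01 i; lra.
have devX S : \sum_i (1 - p i) * ((i \in S)%:R - p i) =
    \sum_(i in S) (1 - p i) - v.
  rewrite [X in _ = X - _]big_mkcond -sumrB; apply: eq_bigr => i _.
  by case: (i \in S); rewrite /= ?mulr0n; ring.
have devY S : \sum_i p i * ((i \in S)%:R - p i) =
    v - \sum_(i | i \notin S) p i.
  rewrite [X in _ = _ - X]big_mkcond -sumrB; apply: eq_bigr => i _.
  by case: (i \in S); rewrite /= ?mulr0n; ring.
have := prod_pmf_dev (fun S => #|S| == j.+1) (fun i => 1 - p i) sg A w1 sg2 hsg.
have := prod_pmf_dev (fun S => #|S| == j) p sg A p01 sg2 hsg.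
set a1 := \sum_(S : {set I} | _) prod_pmf S.
set a0 := \sum_(S : {set I} | _) prod_pmf S.
set d0 := \sum_(S | _) _; set d1 := \sum_(S | _) _ => h0 h1.
(* By [prod_pmf_exchange] the two weighted sums cancel in the bracket, so only [v * (a0 - a1)]
   remains. *)
have E : a0 - a1 = v^-1 * (
  \sum_(S : {set I} | #|S| == j) prod_pmf S * (v - \sum_(i | i \notin S) p i)
  - \sum_(S : {set I} | #|S| == j.+1) prod_pmf S *
      (v - \sum_(i in S) (1 - p i))).
  under eq_bigr do rewrite mulrBr.
  under [in X in _ = _ * (_ - X)]eq_bigr do rewrite mulrBr.
  rewrite !sumrB prod_pmf_exchange -!mulr_suml -/a0 -/a1.
  by field; rewrite gt_eqF.
have B : `|a0 - a1| <= v^-1 * (d0 + d1).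
  rewrite E normrM gtr0_norm ?invr_gt0 // ler_wpM2l ?invr_ge0 ?(ltW v_gt0) //.
  apply: le_trans (ler_normB _ _) _; apply: lerD.
    apply: le_trans (ler_norm_sum _ _ _) _; apply: ler_sum => S _.
    by rewrite normrM ger0_norm ?prod_pmf_ge0 // devY.
  apply: le_trans (ler_norm_sum _ _ _) _; apply: ler_sum => S _.
  by rewrite normrM ger0_norm ?prod_pmf_ge0 // devX [`|v - _|]distrC.
rewrite distrC; apply: le_trans B _.
have d00 : 0 <= d0 + d1.
  by apply: addr_ge0; apply: sumr_ge0 => S _; rewrite mulr_ge0 ?prod_pmf_ge0.
apply: (@le_trans _ _ (v0^-1 * (d0 + d1))).
  by apply: ler_wpM2r => //; rewrite lef_pV2.
rewrite (mulrC sg) -(mulrA v0^-1 sg).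
apply: ler_wpM2l; first by rewrite invr_ge0 ltW.
apply: le_trans (lerD h0 h1) _.
by rewrite le_eqVlt; apply/orP; left; apply/eqP; ring.
Qed.

End ProductMeasure.

(** * Probabilities of output events, by recursion on the remaining queries *)

Section Outputs.
Context {R : realType} {V : finType} {e : rel V}.
Variables (eps : R) (heps : 0 < eps < 1).

Lemma answer_prob_ge0 (cs : corrupt_strategy R e) T h q b :
  0 <= answer_prob eps cs T h q b.
Proof.
rewrite /answer_prob; case: ifP => _; last exact: mass_ge0.
by move/andP: heps => [e0 e1]; case: ifP => _; lra.
Qed.

Lemma answer_prob_sum1 (cs : corrupt_strategy R e) T h q :
  \sum_b answer_prob eps cs T h q b = 1.
Proof.
rewrite big_bool /answer_prob; case: (asked q \in T).
  by case: (subject q \in T); rewrite /=; lra.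
by rewrite -(mass_sum1 (reply cs T h q)) big_bool.
Qed.

Variables (cs : corrupt_strategy R e) (pl : player R e).

Definition event_prob (E : pred {set V}) T k h : R :=
  \sum_(T' | E T') output_prob eps cs pl T k h T'.

Lemma event_prob0 E T h :
  event_prob E T 0 h = \sum_(T' | E T') pl h (inr T').
Proof. by apply: eq_bigr => T' _ /=; rewrite addr0. Qed.

Lemma event_probS E T k h :
  event_prob E T k.+1 h = \sum_(T' | E T') pl h (inr T') +
    \sum_q pl h (inl q) *
      \sum_b answer_prob eps cs T h q b * event_prob E T k (rcons h (q, b)).
Proof.
rewrite /event_prob /= big_split /=; congr (_ + _).
rewrite exchange_big /=; apply: eq_bigr => q _.
rewrite -mulr_sumr; congr (_ * _).
by rewrite exchange_big /=; apply: eq_bigr => b _; rewrite mulr_sumr.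
Qed.

Lemma event_prob_ge0 E T k h : 0 <= event_prob E T k h.
Proof.
elim: k h => [|k IH] h.
  by rewrite event_prob0 sumr_ge0 // => T' _; apply: mass_ge0.
rewrite event_probS addr_ge0 //.
  by rewrite sumr_ge0 // => T' _; apply: mass_ge0.
apply: sumr_ge0 => q _; apply: mulr_ge0; first exact: mass_ge0.
by apply: sumr_ge0 => b _; rewrite mulr_ge0 ?answer_prob_ge0.
Qed.

Lemma move_split h :
  \sum_T' pl h (inr T') + \sum_q pl h (inl q) = 1.
Proof. by rewrite -(mass_sum1 (pl h)) big_sumType /= addrC. Qed.

Lemma event_prob_le1 E T k h : event_prob E T k h <= 1.
Proof.
have final h' : \sum_(T' | E T') pl h' (inr T') <= \sum_T' pl h' (inr T').
  rewrite big_mkcond; apply: ler_sum => T' _.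
  by case: ifP => // _; apply: mass_ge0.
elim: k h => [|k IH] h.
  rewrite event_prob0; apply: le_trans (final h) _.
  rewrite -(move_split h) lerDl.
  by apply: sumr_ge0 => q _; apply: mass_ge0.
rewrite event_probS -(move_split h); apply: lerD => //.
apply: ler_sum => q _; apply: ler_piMr; first exact: mass_ge0.
rewrite -(answer_prob_sum1 cs T h q); apply: ler_sum => b _.
by rewrite ler_piMr ?answer_prob_ge0.
Qed.

Lemma event_prob_disjoint (E1 E2 : pred {set V}) T k h :
  (forall T', E1 T' -> ~~ E2 T') ->
  event_prob E1 T k h + event_prob E2 T k h <= 1.
Proof.
move=> disj; apply: le_trans (event_prob_le1 xpredT T k h).
rewrite /event_prob (big_mkcond E1) (big_mkcond E2) -big_split /=.
apply: ler_sum => T' _.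
have ge0 : 0 <= output_prob eps cs pl T k h T'.
  by have := event_prob_ge0 (pred1 T') T k h; rewrite /event_prob big_pred1_eq.
have := disj T'; case: (E1 T'); case: (E2 T') => // d; rewrite ?addr0 ?add0r //.
by have := d isT.
Qed.

Lemma event_prob_sub (E1 E2 : pred {set V}) T k h :
  (forall T', E1 T' -> E2 T') -> event_prob E1 T k h <= event_prob E2 T k h.
Proof.
move=> sub; rewrite /event_prob (big_mkcond E1) (big_mkcond E2).
apply: ler_sum => T' _.
have ge0 : 0 <= output_prob eps cs pl T k h T'.
  by have := event_prob_ge0 (pred1 T') T k h; rewrite /event_prob big_pred1_eq.
by have := sub T'; case: (E1 T'); case: (E2 T') => // d; have := d isT.
Qed.

(** The player sees T only through the answers; this makes worlds with equal answer laws
    indistinguishable. *)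
Lemma event_prob_eq_answers E T1 T2 k h :
  (forall h q b, answer_prob eps cs T1 h q b = answer_prob eps cs T2 h q b) ->
  event_prob E T1 k h = event_prob E T2 k h.
Proof.
move=> eqA; elim: k h => [|k IH] h; first by rewrite !event_prob0.
rewrite !event_probS; congr (_ + _).
apply: eq_bigr => q _; congr (_ * _).
by apply: eq_bigr => b _; rewrite eqA IH.
Qed.

End Outputs.

(** * Random placements as images of weights on an auxiliary finite type *)

Section Placement.
Context {R : realType} {V : finType} {e : rel V} {W : finType}.
Variables (om : W -> R) (tau : W -> {set V}).
Hypotheses (om0 : forall w, 0 <= om w) (om1 : \sum_w om w = 1).

Definition pushforward (T : {set V}) : R := \sum_(w | tau w == T) om w.

Lemma pushforward_ge0 T : 0 <= pushforward T.
Proof. by apply: sumr_ge0. Qed.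

Lemma pushforward_integral (F : {set V} -> R) :
  \sum_T pushforward T * F T = \sum_w om w * F (tau w).
Proof.
rewrite (partition_big tau xpredT) //=; apply: eq_bigr => T _.
by rewrite mulr_suml; apply: eq_bigr => w /eqP ->.
Qed.

Lemma pushforward_sum1 : \sum_T pushforward T = 1.
Proof.
rewrite -om1; have := pushforward_integral (fun=> 1).
by under eq_bigr do rewrite mulr1; under [RHS]eq_bigr do rewrite mulr1.
Qed.

Definition push_distr : distr R {set V} :=
  Distr pushforward_ge0 pushforward_sum1.

Lemma push_places (rep : {set V} -> history e -> query e -> distr R bool) t :
  (forall w, om w != 0 -> #|tau w| = t) ->
  places_truthful (CorruptStrategy push_distr rep) t.
Proof.
move=> ht T /= nz; apply/eqP; apply: contraNT nz => hT.
rewrite /pushforward big1 // => w /eqP Ew; apply/eqP/negP => /negP w0.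
by move: hT; rewrite -Ew (ht _ w0) eqxx.
Qed.

Lemma success_push eps k (rep : {set V} -> history e -> query e -> distr R bool)
    (pl : player R e) :
  success_prob eps k (CorruptStrategy push_distr rep) pl =
  \sum_w om w * event_prob eps (CorruptStrategy push_distr rep) pl
    (fun T' => #|symdiff (tau w) T'|%:R <= #|V|%:R / 10 :> R) (tau w) k [::].
Proof. exact: pushforward_integral. Qed.

End Placement.

(** * Sums and averages over the layers of the subset lattice *)

Section LayerSums.
Context {R : realType} {I : finType}.

Definition layer_sum (j : nat) (x : {set I} -> R) : R :=
  \sum_(S : {set I} | #|S| == j) x S.

(* Convex and positively homogeneous in x, hence inherited by the nonnegative
   combinations over which the player's transcript is averaged. *)
Definition close_layers (K A B : R) (j : nat) (x : {set I} -> R) : Prop :=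
  `|layer_sum j.+1 x - layer_sum j x| <=
    K * (A * (layer_sum j.+1 x + layer_sum j x) + B * \sum_S x S).

Lemma close_layers_ext K A B j x y :
  (forall S, x S = y S) -> close_layers K A B j x -> close_layers K A B j y.
Proof. by move=> xy; have -> : y = x by apply/funext => S; rewrite xy. Qed.

Lemma close_layers0 K A B j : close_layers K A B j (fun=> 0).
Proof.
rewrite /close_layers /layer_sum !big1 //.
by rewrite subrr normr0 !addr0 !mulr0 addr0 mulr0.
Qed.

Lemma close_layers_add K A B j x y :
  close_layers K A B j x -> close_layers K A B j y ->
  close_layers K A B j (fun S => x S + y S).
Proof.
have D i : layer_sum i (fun S => x S + y S) = layer_sum i x + layer_sum i y.
  by rewrite /layer_sum big_split.
rewrite /close_layers !D big_split /= => hx hy.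
set x1 := layer_sum j.+1 x in hx *; set y1 := layer_sum j.+1 y in hy *.
set x0 := layer_sum j x in hx *; set y0 := layer_sum j y in hy *.
have -> : x1 + y1 - (x0 + y0) = (x1 - x0) + (y1 - y0) by ring.
apply: le_trans (ler_normD _ _) _; apply: le_trans (lerD hx hy) _.
by rewrite le_eqVlt; apply/orP; left; apply/eqP; ring.
Qed.

Lemma close_layers_scale K A B j c x : 0 <= c ->
  close_layers K A B j x -> close_layers K A B j (fun S => c * x S).
Proof.
move=> c0; rewrite /close_layers /layer_sum -!mulr_sumr => hx.
rewrite -mulrBr normrM (ger0_norm c0).
apply: le_trans (ler_wpM2l c0 hx) _.
by rewrite le_eqVlt; apply/orP; left; apply/eqP; ring.
Qed.

Lemma close_layers_sum K A B j (W : finType) (x : W -> {set I} -> R) :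
  (forall w, close_layers K A B j (x w)) ->
  close_layers K A B j (fun S => \sum_w x w S).
Proof.
move=> hx; have -> : (fun S => \sum_w x w S) = \sum_w x w.
  by apply/funext => S; rewrite fct_sumE.
apply: (big_ind (close_layers K A B j)) => //.
- exact: close_layers0.
- exact: close_layers_add.
Qed.

Lemma layer_sum1 j : layer_sum j (fun=> 1) = 'C(#|I|, j)%:R.
Proof.
rewrite /layer_sum sumr_const -card_draws; congr (_%:R).
by apply: eq_card => S; rewrite inE.
Qed.

Lemma layer_sum_le j x y :
  (forall S, x S <= y S) -> layer_sum j x <= layer_sum j y.
Proof. by move=> h; apply: ler_sum. Qed.

Lemma layer_sum_ge0 j x : (forall S, 0 <= x S) -> 0 <= layer_sum j x.
Proof. by move=> h; apply: sumr_ge0. Qed.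

Definition layer_avg (j : nat) (x : {set I} -> R) : R :=
  layer_sum j x / 'C(#|I|, j)%:R.

(** Adjacent layers have different sizes, so closeness is also required of the constant function 1,
    which controls the change of normalisation. The factor L compares the whole cube with layer
    j. *)
Lemma layer_avg_step K A B L j x :
    (forall S, 0 <= x S <= 1) -> 0 <= K -> 0 <= A -> 0 <= B ->
    close_layers K A B j x -> close_layers K A B j (fun=> 1) ->
    (j < #|I|)%N -> ('C(#|I|, j.+1) <= 2 * 'C(#|I|, j))%N ->
    2 ^+ #|I| <= L * 'C(#|I|, j)%:R :> R ->
  `|layer_avg j.+1 x - layer_avg j x| <= 2 * K * (3 * A + B * L).
Proof.
move=> x01 K0 A0 B0 hx h1 jI hC hL.
have x0 S : 0 <= x S by have /andP[] := x01 S.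
have x1 S : x S <= 1 by have /andP[] := x01 S.
have C0 : 0 < 'C(#|I|, j)%:R :> R by rewrite ltr0n bin_gt0 ltnW.
have C1 : 0 < 'C(#|I|, j.+1)%:R :> R by rewrite ltr0n bin_gt0.
have hC' : 'C(#|I|, j.+1)%:R <= 2 * 'C(#|I|, j)%:R :> R.
  by rewrite -natrM ler_nat.
have sum1 : \sum_(S : {set I}) 1 = 2 ^+ #|I| :> R.
  by rewrite sumr_const -natrX -(cardsT I) -card_powerset powersetT cardsT.
move: h1 hx; rewrite /close_layers !layer_sum1 sum1 /layer_avg.
have l1 := layer_sum_le j.+1 _ _ x1; have l0 := layer_sum_le j _ _ x1.
rewrite !layer_sum1 in l1 l0.
have l1' := layer_sum_ge0 j.+1 _ x0; have l0' := layer_sum_ge0 j _ x0.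
have lS : \sum_S x S <= 2 ^+ #|I| by rewrite -sum1; apply: ler_sum.
move: l1 l0 l1' l0' lS C0 C1 hC' hL.
set P1 := layer_sum j.+1 x; set P0 := layer_sum j x.
set c0 := 'C(#|I|, j)%:R; set c1 := 'C(#|I|, j.+1)%:R.
set N := 2 ^+ #|I|; set X := \sum_S x S.
move=> l1 l0 l1' l0' lS C0 C1 hC' hL h1 hx.
(* The 3 comes from [c1 + c0 <= 3 * c0]. This D bounds both the change of the sums and the change of
   the layer sizes, whence the final factor 2. *)
pose D := K * (3 * A + B * L) * c0.
have DN : K * (A * (c1 + c0) + B * N) <= D.
  rewrite /D -mulrA ler_wpM2l // mulrDl -(mulrA B) lerD // ?ler_wpM2l //.
  by rewrite [3 * A]mulrC -mulrA ler_wpM2l //; lra.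
have D1 : `|c1 - c0| <= D by apply: le_trans h1 DN.
have D2 : `|P1 - P0| <= D.
  apply: le_trans hx _; apply: le_trans DN; rewrite ler_wpM2l //.
  by rewrite lerD // ?ler_wpM2l // lerD.
have -> : P1 / c1 - P0 / c0 = (P1 - P0) / c0 + P1 / c1 * ((c0 - c1) / c0).
  by field; rewrite !gt_eqF.
apply: le_trans (ler_normD _ _) _.
have b1 : `|(P1 - P0) / c0| <= K * (3 * A + B * L).
  by rewrite normrM normfV (gtr0_norm C0) ler_pdivrMr.
have b2 : `|P1 / c1 * ((c0 - c1) / c0)| <= K * (3 * A + B * L).
  rewrite normrM (_ : `|P1 / c1| = P1 / c1); last first.
    by rewrite ger0_norm // divr_ge0 // ltW.
  apply: (@le_trans _ _ `|(c0 - c1) / c0|).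
    by rewrite ler_piMl // ler_pdivrMr // mul1r.
  by rewrite normrM normfV (gtr0_norm C0) distrC ler_pdivrMr.
by lra.
Qed.

Lemma layer_avg_telescope (x : {set I} -> R) (J s : nat) (D : R) : (s <= J)%N ->
  (forall j, (J - s <= j < J)%N -> `|layer_avg j.+1 x - layer_avg j x| <= D) ->
  `|layer_avg J x - layer_avg (J - s) x| <= s%:R * D.
Proof.
elim: s => [|s IH] sJ h; first by rewrite subn0 subrr normr0 mul0r.
have E : (J - s = (J - s.+1).+1)%N by lia.
have h1 : `|layer_avg J x - layer_avg (J - s) x| <= s%:R * D.
  by apply: IH; [lia | move=> j hj; apply: h; lia].
have h2 : `|layer_avg (J - s) x - layer_avg (J - s.+1) x| <= D.
  by rewrite {1}E; apply: h; lia.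
rewrite -natr1 mulrDl mul1r; apply: le_trans (ler_distD (layer_avg (J - s) x) _ _) _.
exact: lerD.
Qed.

End LayerSums.

(** * Binomial coefficients at and near the middle *)

Section CentralBinomials.
Variable R : realType.

(** Below the middle the ratio [(m - k) / (k + 1)] of successive coefficients is at least 1; the
    upper half follows by symmetry. *)
Lemma leq_bin_half (m i : nat) : ('C(m, i) <= 'C(m, m./2))%N.
Proof.
have up k : (k < m./2)%N -> ('C(m, k) <= 'C(m, k.+1))%N.
  move=> km; rewrite -(@leq_pmul2l k.+1) // mul_bin_left leq_mul2r.
  by apply/orP; right; lia.
have low k : ('C(m, m./2 - k) <= 'C(m, m./2))%N.
  elim: k => [|k IH]; first by rewrite subn0.
  have [hk|hk] := leqP (m./2) k.
    by rewrite (_ : m./2 - k.+1 = m./2 - k)%N //; lia.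
  apply: leq_trans IH; rewrite (_ : m./2 - k = (m./2 - k.+1).+1)%N; last lia.
  by apply: up; lia.
have [im|im] := leqP i m; last by rewrite bin_small.
have [h|h] := leqP i m./2.
  by rewrite -(subKn h) low.
by rewrite -bin_sub // (_ : m - i = m./2 - (m./2 - (m - i)))%N ?low //; lia.
Qed.

Lemma exp2_le_central_bin (m : nat) : (2 ^ m <= m.+1 * 'C(m, m./2))%N.
Proof.
rewrite -[m.+1]card_ord -sum_nat_const -[2%N]/(1 + 1)%N expnDn.
by apply: leq_sum => i _; rewrite !exp1n !muln1 leq_bin_half.
Qed.

(** The ratio is [(j + 1) / (m - j) = 1 - (m - 2 j - 1) / (m - j)], where the numerator is at most
    [2 s] and the denominator at least [m / 2]. *)
Lemma near_central_bin_step (m s j : nat) : (0 < m)%N ->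
  (m./2 - s <= j < m./2)%N ->
  (1 - 4 * s%:R / m%:R) * 'C(m, j.+1)%:R <= 'C(m, j)%:R :> R.
Proof.
move=> m0 hj; have mR : 0 < m%:R :> R by rewrite ltr0n.
have jm : 0 < (m - j)%:R :> R by rewrite ltr0n; lia.
rewrite -(ler_pM2l jm) -(natrM R _ 'C(m, j)) -mul_bin_left natrM mulrA.
apply: ler_wpM2r; first exact: ler0n.
have -> : (m - j)%:R * (1 - 4 * s%:R / m%:R) =
   ((m - j)%:R * (m%:R - 4 * s%:R)) / m%:R :> R by field; rewrite gt_eqF.
rewrite ler_pdivrMr //.
have a1 : (m - j)%:R = m%:R - j%:R :> R by rewrite natrB //; lia.
have a2 : m%:R <= 2 * j%:R + 2 * s%:R + 1 :> R.
  by rewrite -!natrM -!natrD natr1 ler_nat; lia.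
have a3 : 2 * j%:R + 2 <= m%:R :> R.
  by rewrite -!natrM -!natrD ler_nat; lia.
rewrite a1 -[j.+1%:R]natr1; have s0 : 0 <= s%:R :> R by [].
have := mulr_ge0 s0 (_ : 0 <= 2 * j%:R + 2 * s%:R + 1 - m%:R :> R).
have := mulr_ge0 (ltW mR) (_ : 0 <= 2 * j%:R + 2 * s%:R + 1 - m%:R :> R).
by nra.
Qed.

(** At most s steps lead from j to the middle, each losing a factor at least [1 - 4 s / m]. As in
    Bernoulli's inequality, the total relative loss is at most [4 s ^ 2 / m <= 1 / 2]. *)
Lemma near_central_bin (m s j : nat) : (0 < m)%N ->
  (8 * s ^ 2 <= m)%N -> (m./2 - s <= j <= m./2)%N ->
  'C(m, m./2)%:R <= 2 * 'C(m, j)%:R :> R.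
Proof.
move=> m0 hs hj; have mR : 0 < m%:R :> R by rewrite ltr0n.
have s0 : 0 <= s%:R :> R by [].
have hsR : 8 * s%:R ^+ 2 <= m%:R :> R by rewrite -natrX -natrM ler_nat.
have u0 : 0 <= 4 * s%:R / m%:R :> R by rewrite divr_ge0 ?mulr_ge0.
have u1 : 4 * s%:R / m%:R * s%:R <= 1 / 2 :> R.
  by rewrite mulrAC ler_pdivrMr //; move: hsR; rewrite expr2; lra.
have main i : (i <= s)%N -> (i <= m./2)%N ->
    (1 - 4 * s%:R / m%:R * i%:R) * 'C(m, m./2)%:R <= 'C(m, m./2 - i)%:R :> R.
  elim: i => [|i IH] is_ im; first by rewrite mulr0 subr0 mul1r subn0.
  have hi : (m./2 - s <= m./2 - i.+1 < m./2)%N by lia.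
  have := near_central_bin_step m s _ m0 hi.
  rewrite (_ : (m./2 - i.+1).+1 = m./2 - i)%N; last by lia.
  apply: le_trans.
  have isR : i%:R + 1 <= s%:R :> R by rewrite natr1 ler_nat.
  have u2 : 4 * s%:R / m%:R * (i%:R + 1) <= 1 / 2 :> R.
    by apply: le_trans u1; apply: ler_wpM2l.
  have i0 : 0 <= i%:R :> R by [].
  have u3 : 4 * s%:R / m%:R <= 1 / 2 :> R.
    by apply: le_trans u2; rewrite ler_peMr // lerDr.
  have := IH (ltnW is_) (ltnW im).
  rewrite -[i.+1%:R]natr1; set u := 4 * s%:R / m%:R in u0 u1 u2 u3 *.
  set c := 'C(m, m./2)%:R; have c0 : 0 <= c by apply: ler0n.
  move=> h; have u4 : 0 <= 1 - u by lra.
  apply: le_trans (ler_wpM2l u4 h); rewrite mulrA ler_wpM2r //.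
  by have := mulr_ge0 (mulr_ge0 u0 u0) i0; nra.
have hj1 : (m./2 - j <= s)%N by lia.
have hj2 : (m./2 - j <= m./2)%N by lia.
have := main _ hj1 hj2; rewrite subKn; last by lia.
have : 4 * s%:R / m%:R * (m./2 - j)%:R <= 1 / 2 :> R.
  by apply: le_trans u1; apply: ler_wpM2l => //; rewrite ler_nat.
have : 0 <= 'C(m, m./2)%:R :> R by [].
by nra.
Qed.

End CentralBinomials.

(** * The mirrored answering strategy and the posterior of the hidden set *)

Section MutualAccusation.
Context {R : realType} {V : finType} {e : rel V}.
Variables (eps : R) (heps : 0 < eps < 1).

(* Truthful and corrupt vertices alike vouch, up to noise, for their own side:
   the law is the same for T and for its complement. *)
Definition mutual_law (T : {set V}) (q : query e) (b : bool) : R :=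
  if b == ((asked q \in T) == (subject q \in T)) then 1 - eps else eps.

Lemma mutual_law_ge0 T q b : 0 <= mutual_law T q b.
Proof. by have /andP[e0 e1] := heps; rewrite /mutual_law; case: ifP => _; lra. Qed.

Lemma mutual_law_sum1 T q : \sum_b mutual_law T q b = 1.
Proof.
rewrite big_bool /mutual_law.
by case: (asked q \in T); case: (subject q \in T); rewrite /=; lra.
Qed.

Definition mutual_distr T q : distr R bool :=
  Distr (mutual_law_ge0 T q) (mutual_law_sum1 T q).

Definition mutual_strategy (P : distr R {set V}) : corrupt_strategy R e :=
  CorruptStrategy P (fun T _ q => mutual_distr T q).

Lemma mutual_answer P T h q b :
  answer_prob eps (mutual_strategy P) T h q b = mutual_law T q b.
Proof.
rewrite /answer_prob /= /mutual_law.
by case: (asked q \in T) => //; case: (subject q \in T).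
Qed.

Lemma mutual_lawC T q b : mutual_law (~: T) q b = mutual_law T q b.
Proof.
rewrite /mutual_law !finset.in_setC.
by case: (asked q \in T); case: (subject q \in T).
Qed.

Variables (I : finType) (iota : I -> V) (G : {set V}).
Hypotheses (iota_inj : injective iota)
  (iota_indep : forall i i', ~~ e (iota i) (iota i'))
  (iotaG : forall i, iota i \notin G).

(** Outside the image of [iota] membership is frozen by G; only the part indexed by S is hidden from
    the player. *)
Definition world (S : {set I}) : {set V} := G :|: [set iota i | i in S].

Lemma in_world_iota S i : (iota i \in world S) = (i \in S).
Proof. by rewrite finset.in_setU (negbTE (iotaG i)) /= (mem_imset _ _ iota_inj). Qed.

Lemma in_world_out S v : (forall i, v != iota i) -> (v \in world S) = (v \in G).
Proof.
move=> nv; rewrite finset.in_setU; case: (v \in G) => //=.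
by apply/negbTE/imsetP => -[i _ vi]; move: (nv i); rewrite vi eqxx.
Qed.

Lemma card_world S : #|world S| = (#|G| + #|S|)%N.
Proof.
rewrite cardsU (card_imset _ iota_inj) (_ : _ :&: _ = finset.set0) ?cards0 ?subn0 //.
apply/setP => v; rewrite finset.in_setI finset.in_set0; apply/negP.
by move=> /andP[vG /imsetP[i _ vi]]; move: (iotaG i); rewrite -vi vG.
Qed.

Variables (rho : R).
Hypotheses (rho1 : expR (- rho) * (1 - eps) <= eps)
  (rho2 : expR (- rho) * eps <= 1 - eps).

(** A query joins neighbours and the image of [iota] is independent, so it touches at most one
    hidden vertex. Its answer then changes the odds of that vertex by a factor at most
    [expR rho]. *)
Lemma mutual_law_local (q : query e) b :
  (exists2 c, 0 < c & forall S, mutual_law (world S) q b = c) \/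
  (exists (i : I) (al be : R), [/\ 0 < al, 0 < be, expR (- rho) * al <= be,
     expR (- rho) * be <= al &
     forall S, mutual_law (world S) q b = if i \in S then al else be]).
Proof.
have /andP[e0 e1] := heps.
pose lw' (c x : bool) := if c == x then 1 - eps else eps.
have lw0 c x : 0 < lw' c x by rewrite /lw'; case: ifP => _; lra.
have lwr c x : expR (- rho) * lw' c x <= lw' c (~~ x).
  by rewrite /lw'; case: x; case: c.
pose lw := lw' b.
have loc i c (f : {set I} -> bool) : (forall S, f S = ((i \in S) == c)) ->
    exists (i : I) (al be : R), [/\ 0 < al, 0 < be, expR (- rho) * al <= be,
     expR (- rho) * be <= al & forall S, lw (f S) = if i \in S then al else be].
  move=> fE; exists i, (lw c), (lw (~~ c)); split; rewrite ?lw0 //.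
  - exact: lwr.
  - by rewrite -{2}(negbK c); apply: lwr.
  - by move=> S; rewrite fE; case: (i \in S); case: (c).
have euv : e (asked q) (subject q) := valP q.
rewrite /mutual_law; set u := asked q in euv *; set v := subject q in euv *.
have [/existsP[i /eqP ui]|/existsPn uN] := boolP [exists i, u == iota i].
  have vN i' : v != iota i'.
    by apply/eqP => vi; move: (iota_indep i i'); rewrite -ui -vi euv.
  right; apply: (loc i (v \in G)) => S.
  by rewrite ui in_world_iota in_world_out.
have [/existsP[i /eqP vi]|/existsPn vN] := boolP [exists i, v == iota i].
  right; apply: (loc i (u \in G)) => S.
  by rewrite vi in_world_iota in_world_out // eq_sym.
left; exists (lw ((u \in G) == (v \in G))) => [|S]; first exact: lw0.
by rewrite !in_world_out.
Qed.

(** Only the answers are counted: the player's own draws do not depend on S and factor out. *)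
Definition likelihood (S : {set I}) (h : history e) : R :=
  \prod_(x <- h) mutual_law (world S) x.1 x.2.

(** Each answer rescales the pair [a i], [b i] of at most one coordinate, so the product form
    persists. Here [q i] counts the queries touching vertex i, with real values for the later
    convexity argument. *)
Lemma likelihood_product (h : history e) :
  exists (c : R) (a b q : I -> R),
    [/\ 0 <= c, forall i, 0 < a i /\ 0 < b i,
      forall i, expR (- (rho * q i)) * a i <= b i /\
                expR (- (rho * q i)) * b i <= a i,
      \sum_i q i <= (size h)%:R &
      forall S, likelihood S h = c * \prod_i (if i \in S then a i else b i)].
Proof.
elim: h => [|[x y] h [c [a [b [q [c0 ab0 abq qs hE]]]]]].
  exists 1, (fun=> 1), (fun=> 1), (fun=> 0); split=> //.
  - by move=> i; rewrite mulr0 oppr0 expR0 mulr1.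
  - by rewrite big1.
  - move=> S; rewrite /likelihood big_nil big1 ?mulr1 // => i _.
    by case: ifP.
have likE S : likelihood S ((x, y) :: h) =
    mutual_law (world S) x y * likelihood S h by rewrite /likelihood big_cons.
have [[k k0 kE]|[i [al [be [al0 be0 alb bea lE]]]]] := mutual_law_local x y.
  exists (k * c), a, b, q; split=> //.
  - by rewrite mulr_ge0 // ltW.
  - by apply: le_trans qs _; rewrite ler_nat.
  - by move=> S; rewrite likE kE hE mulrA.
exists c, (fun j => if j == i then al * a j else a j),
  (fun j => if j == i then be * b j else b j),
  (fun j => if j == i then q j + 1 else q j); split=> //.
- move=> j; have [a0 b0] := ab0 j.
  by case: eqP => // _; split; apply: mulr_gt0.
- move=> j; have [h1 h2] := abq j; have [a0 b0] := ab0 j; case: eqP => // _.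
  have -> : expR (- (rho * (q j + 1))) = expR (- rho) * expR (- (rho * q j)).
    by rewrite -expRD; congr expR; ring.
  by split; rewrite mulrACA; apply: ler_pM => //;
    apply: mulr_ge0; rewrite ?expR_ge0 // ltW.
- rewrite (bigD1 i) //= eqxx.
  have -> : \sum_(j | j != i) (if j == i then q j + 1 else q j) =
      \sum_(j | j != i) q j by apply: eq_bigr => j /negbTE ->.
  by rewrite -natr1; move: qs; rewrite (bigD1 i) //=; lra.
- move=> S; rewrite likE hE lE (bigD1 i) //= [in RHS](bigD1 i) //= eqxx.
  have -> : \prod_(j | j != i) (if j \in S then if j == i then al * a j else a j
        else if j == i then be * b j else b j) =
      \prod_(j | j != i) (if j \in S then a j else b j).
    by apply: eq_bigr => j /negbTE ->.
  by case: (i \in S); ring.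
Qed.

(** The variance is [a * b / (a + b) ^+ 2]. With M the larger of a and b,
    [(a + b) ^+ 2 <= 4 * M ^+ 2] and [x * M ^+ 2 <= a * b]. *)
Lemma ratio_variance (a b x : R) : 0 < a -> 0 < b -> x * a <= b -> x * b <= a ->
  x / 4 <= a / (a + b) * (1 - a / (a + b)).
Proof.
move=> a0 b0 xa xb; have ab0 : 0 < a + b by lra.
have -> : a / (a + b) * (1 - a / (a + b)) = a * b / (a + b) ^+ 2.
  by field; rewrite gt_eqF.
rewrite ler_pdivlMr ?exprn_gt0 // mulrAC ler_pdivrMr //.
have [ab|ab] := leP a b.
  have := ler_wpM2r (ltW b0) xb.
  by have [x0|x0] := leP 0 x; have := sqr_ge0 (a + b); rewrite !expr2; nra.
have := ler_wpM2r (ltW a0) xa.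
by have [x0|x0] := leP 0 x; have := sqr_ge0 (a + b); rewrite !expr2; nra.
Qed.

Hypotheses (rho0 : 0 <= rho) (I0 : (0 < #|I|)%N).
Variables (Q : nat) (A : R).
Hypothesis (A0 : 0 <= A).

(* By convexity of exp, the total posterior variance is smallest when the
   queries are spread evenly over the hidden vertices. *)
Definition min_variance : R :=
  #|I|%:R / 4 * expR (- (rho * (Q%:R / #|I|%:R))).

(** This and [tail_factor] are the [sg / v0] and the last summand of [prod_pmf_step], with [sg]
    twice the square root of [#|I|]. *)
Definition step_factor : R := 2 * Num.sqrt #|I|%:R / min_variance.
Definition tail_factor : R := 4 * expR 1 * expR (- A).

Lemma min_variance_gt0 : 0 < min_variance.
Proof. by rewrite mulr_gt0 ?expR_gt0 // divr_gt0 ?ltr0n. Qed.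

Lemma min_variance_le (q : I -> R) : \sum_i q i <= Q%:R ->
  min_variance <= \sum_i expR (- (rho * q i)) / 4.
Proof.
move=> qQ; have mR : 0 < #|I|%:R :> R by rewrite ltr0n.
set q0 : R := Q%:R / #|I|%:R; set E := expR (- (rho * q0)).
(* Each exponential lies above its tangent line at [q0]; the linear terms sum to something
   nonnegative because [\sum_i q i <= Q%:R]. *)
apply: (@le_trans _ _ (\sum_i E * (1 - rho * (q i - q0)) / 4)).
  rewrite -mulr_suml -mulr_sumr sumrB -mulr_sumr sumrB !sumr_const.
  rewrite -[1 *+ _]mulr_natr mul1r -[q0 *+ _]mulr_natr.
  rewrite (_ : q0 * #|I|%:R = Q%:R); last by rewrite /q0 mulfVK ?gt_eqF.
  rewrite /min_variance -/q0 -/E.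
  have : 0 <= E * (rho * (Q%:R - \sum_i q i)).
    by rewrite mulr_ge0 ?expR_ge0 // mulr_ge0 // subr_ge0.
  by nra.
apply: ler_sum => i _; rewrite ler_wpM2r //.
have -> : expR (- (rho * q i)) = E * expR (- (rho * (q i - q0))).
  by rewrite -expRD; congr expR; ring.
by rewrite ler_wpM2l ?expR_ge0 //; apply: expR_ge1Dx.
Qed.

Lemma likelihood_close (h : history e) (j : nat) : (size h <= Q)%N ->
  close_layers step_factor A tail_factor j (fun S => likelihood S h).
Proof.
move=> hQ; have [c [a [b [q [c0 ab0 abq qs hE]]]]] := likelihood_product h.
pose p i := a i / (a i + b i).
have s0 i : 0 < a i + b i by have [? ?] := ab0 i; apply: addr_gt0.
have p01 i : 0 <= p i <= 1.
  have [a0 b0] := ab0 i.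
  by rewrite /p divr_ge0 ?(ltW a0) ?(ltW (s0 i)) // ler_pdivrMr // mul1r lerDl ltW.
(* Normalising each coordinate turns the likelihood into a multiple of the posterior product
   measure. *)
have lE S : c * \prod_i (a i + b i) * prod_pmf R I p S = likelihood S h.
  rewrite hE -mulrA -big_split /=; congr (_ * _); apply: eq_bigr => i _.
  by rewrite /p; case: ifP => _; field; rewrite gt_eqF.
apply: close_layers_ext lE _; apply: close_layers_scale.
  by rewrite mulr_ge0 // prodr_ge0 // => i _; apply: ltW.
have mR : 1 <= #|I|%:R :> R by rewrite ler1n.
rewrite /close_layers prod_pmf_sum1 mulr1 /tail_factor.
apply: prod_pmf_step => //.
- by have := ler_wsqrtr mR; rewrite sqrtr1; lra.
- by rewrite exprMn sqr_sqrtr; nra.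
- exact: min_variance_gt0.
have qQ : \sum_i q i <= Q%:R by apply: le_trans qs _; rewrite ler_nat.
apply: le_trans (min_variance_le q qQ) _; apply: ler_sum => i _.
by have [a0 b0] := ab0 i; have [h1 h2] := abq i; apply: ratio_variance.
Qed.

(** Unfolding one move writes the weighted event probability as a combination of likelihoods of
    longer histories, with nonnegative coefficients free of S; such combinations preserve
    [close_layers]. *)
Lemma event_close P (pl : player R e) (E : pred {set V}) k h j :
  (size h + k <= Q)%N ->
  close_layers step_factor A tail_factor j (fun S =>
    likelihood S h * event_prob eps (mutual_strategy P) pl E (world S) k h).
Proof.
elim: k h => [|k IH] h hk.
  pose c := \sum_(T' | E T') pl h (inr T').
  apply: (close_layers_ext _ _ _ _ (fun S => c * likelihood S h)) => [S|].
    by rewrite event_prob0 mulrC.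
  apply: close_layers_scale; first by apply: sumr_ge0 => T' _; apply: mass_ge0.
  by apply: likelihood_close; lia.
pose c := \sum_(T' | E T') pl h (inr T').
apply: (close_layers_ext _ _ _ _ (fun S => c * likelihood S h + \sum_q
   pl h (inl q) * \sum_b likelihood S (rcons h (q, b)) *
     event_prob eps (mutual_strategy P) pl E (world S) k (rcons h (q, b)))) => [S|].
  rewrite event_probS mulrDr mulrC; congr (_ + _).
  rewrite mulr_sumr; apply: eq_bigr => q _; rewrite [RHS]mulrCA; congr (_ * _).
  rewrite mulr_sumr; apply: eq_bigr => b _.
  by rewrite mutual_answer mulrA /likelihood big_rcons.
apply: close_layers_add.
  apply: close_layers_scale; first by apply: sumr_ge0 => T' _; apply: mass_ge0.
  by apply: likelihood_close; lia.
apply: close_layers_sum => q; apply: close_layers_scale; first exact: mass_ge0.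
apply: close_layers_sum => b; apply: IH.
by rewrite size_rcons; lia.
Qed.

Definition world_event_prob P (pl : player R e) (E : pred {set V}) S : R :=
  event_prob eps (mutual_strategy P) pl E (world S) Q [::].

Lemma event_avg_close P (pl : player R e) (E : pred {set V}) (s : nat) (L : R) :
  (0 < s)%N -> (8 * s ^ 2 <= #|I|)%N -> (s <= #|I|./2)%N ->
  2 * (#|I|%:R + 1) <= L ->
  `|layer_avg #|I|./2 (world_event_prob P pl E) -
    layer_avg (#|I|./2 - s) (world_event_prob P pl E)| <=
  s%:R * (2 * step_factor * (3 * A + tail_factor * L)).
Proof.
move=> s0 hs sI hL; apply: layer_avg_telescope => // j hj.
have mR : 0 < #|I|%:R :> R by rewrite ltr0n.
have L0 : 0 <= L by lra.
have bJ : 'C(#|I|, #|I|./2)%:R <= 2 * 'C(#|I|, j)%:R :> R.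
  by apply: (near_central_bin _ _ s) => //; move: hj; clear; lia.
have l1 S : likelihood S [::] = 1 by rewrite /likelihood big_nil.
apply: layer_avg_step => //.
- by move=> S; rewrite event_prob_ge0 // event_prob_le1.
- by rewrite /step_factor divr_ge0 ?(ltW min_variance_gt0) // mulr_ge0 ?sqrtr_ge0.
- by rewrite /tail_factor !mulr_ge0 ?expR_ge0.
- have := event_close P pl E Q [::] j (leqnn Q); apply: close_layers_ext => S.
  by rewrite l1 mul1r.
- by apply: close_layers_ext (likelihood_close [::] j _).
- by move: hj; clear; lia.
- have := leq_bin_half #|I| j.+1.
  rewrite -(ler_nat R) => /le_trans /(_ bJ); rewrite -natrM ler_nat //.
(* The middle layer holds at least a fraction [1 / (#|I| + 1)] of the cube, and layer j at least
   half as much; this is the origin of L. *)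
have := exp2_le_central_bin #|I|; rewrite -(ler_nat R) natrX natrM => /le_trans; apply.
apply: (@le_trans _ _ (#|I|.+1%:R * (2 * 'C(#|I|, j)%:R))); first by rewrite ler_wpM2l.
rewrite mulrA ler_wpM2r // mulrC.
by rewrite -[#|I|.+1%:R]natr1.
Qed.

End MutualAccusation.

(** * Independent sets, the trivial bound, and the case without a truthful majority *)

Section SuccessBounds.
Context {R : realType} {V : finType} {e : rel V}.
Variables (eps : R) (heps : 0 < eps < 1).

Lemma subset_of_card (T : finType) (A : {set T}) k :
  (k <= #|A|)%N -> exists2 B : {set T}, B \subset A & #|B| = k.
Proof.
move=> /card_geqP[s [us sk sA]]; exists [set x in s]; last first.
  by rewrite -sk -(card_uniqP us); apply: eq_card => x; rewrite inE.
by apply/fintype.subsetP => x; rewrite inE => /sA.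
Qed.

(** The closed neighbourhoods of a maximal independent set cover the graph, and each has at most
    [d.+1] vertices. *)
Lemma independent_set d : simple_graph e -> max_degree_le e d ->
  exists2 F : {set V}, {in F &, forall x y, ~~ e x y} & (#|V| <= d.+1 * #|F|)%N.
Proof.
move=> [esym eirr] edeg.
pose indep (X : {set V}) := [forall x in X, forall y in X, ~~ e x y].
have indep0 : indep finset.set0 by apply/forall_inP => x; rewrite finset.in_set0.
have [F /maxsetP[Findep Fmax] _] := maxset_exists indep0.
have Fin x y : x \in F -> y \in F -> ~~ e x y.
  by move=> xF yF; have /forall_inP/(_ x xF)/forall_inP/(_ y yF) := Findep.
exists F => //.
have cover : [set: V] \subset \bigcup_(x in F) (x |: [set y | e x y]).
  apply/fintype.subsetP => v _; apply/finset.bigcupP.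
  have [vF|vF] := boolP (v \in F); first by exists v; rewrite // finset.in_setU1 eqxx.
  have [/exists_inP[x xF exv]|/exists_inPn noe] := boolP [exists x in F, e x v].
    by exists x => //; rewrite finset.in_setU1 finset.inE exv orbT.
  case/negP: vF; suff <- : v |: F = F by rewrite finset.in_setU1 eqxx.
  apply: Fmax; last exact: finset.subsetUr.
  apply/forall_inP => x /setU1P[->|xF]; apply/forall_inP => y /setU1P[->|yF].
  - by rewrite eirr.
  - by rewrite esym noe.
  - exact: noe.
  - exact: Fin.
rewrite -cardsT; apply: leq_trans (subset_leq_card cover) _.
apply: (@leq_trans (\sum_(x in F) #|x |: [set y | e x y]|)).
  apply: (big_ind2 (fun (X : {set V}) n => (#|X| <= n)%N)) => //.
    by rewrite cards0.
  move=> X1 n1 X2 n2 h1 h2.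
  exact: leq_trans (leq_card_setU _ _) (leq_add h1 h2).
rewrite mulnC -sum_nat_const; apply: leq_sum => x _.
by apply: leq_trans (leq_card_setU _ _) _; rewrite cards1 add1n ltnS.
Qed.

Lemma card_symdiff_triangle (A B C : {set V}) :
  (#|symdiff A B| <= #|symdiff A C| + #|symdiff B C|)%N.
Proof.
apply: leq_trans (leq_card_setU _ _); apply/subset_leq_card/fintype.subsetP => x.
rewrite !finset.inE.
by case: (x \in A); case: (x \in B); case: (x \in C).
Qed.

Lemma success_prob_le1 k (cs : corrupt_strategy R e) (pl : player R e) :
  success_prob eps k cs pl <= 1.
Proof.
rewrite -(mass_sum1 (placement cs)); apply: ler_sum => T _.
rewrite ler_piMr ?mass_ge0 //; exact: (event_prob_le1 _ heps).
Qed.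

Lemma strategy_exists (t : nat) : (t <= #|V|)%N ->
  exists cs : corrupt_strategy R e, places_truthful cs t.
Proof.
rewrite -cardsT => /subset_of_card[T _ Tt].
have om0 (w : unit) : 0 <= 1 :> R by [].
have om1 : \sum_(w : unit) 1 = 1 :> R by rewrite sumr_const card_unit.
exists (CorruptStrategy (push_distr (fun=> 1) (fun=> T) om0 om1)
  (fun T _ q => mutual_distr eps heps T q)).
exact: push_places.
Qed.

(* With enough corrupt vertices, as many of them as there are truthful ones
   behave exactly like a second truthful set, disjoint from T. *)
Lemma success_minority (k t : nat) :
  (t + t <= #|V|)%N -> (#|V| < 10 * t)%N ->
  exists cs : corrupt_strategy R e, places_truthful cs t /\
    forall pl : player R e, success_prob eps k cs pl <= 1 / 2.
Proof.
move=> tV Vt.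
have [Ta _ Tat] : exists2 B : {set V}, B \subset [set: V] & #|B| = t.
  by apply: subset_of_card; rewrite cardsT; lia.
have [Tb Tba Tbt] : exists2 B : {set V}, B \subset ~: Ta & #|B| = t.
  by apply: subset_of_card; have := cardsC Ta; lia.
have dab x : x \in Tb -> x \notin Ta.
  by move=> /(fintype.subsetP Tba); rewrite finset.in_setC.
(* Members of [Ta] answer as if [Ta] were truthful, and all others, even those outside [Tb], as if
   [Tb] were. This law fits both placements. *)
pose truth (q : query e) :=
  if asked q \in Ta then subject q \in Ta else subject q \in Tb.
pose law (q : query e) (b : bool) := if b == truth q then 1 - eps else eps.
have /andP[e0 e1] := heps.
have law0 q b : 0 <= law q b by rewrite /law; case: ifP => _; lra.
have law1 q : \sum_b law q b = 1.
  by rewrite big_bool /law; case: (truth q); rewrite /=; lra.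
pose om (w : bool) : R := 1 / 2.
have om0 w : 0 <= om w by rewrite /om.
have om1 : \sum_w om w = 1 by rewrite big_bool /om /= -splitr.
pose tau (w : bool) := if w then Ta else Tb.
pose cs := CorruptStrategy (push_distr om tau om0 om1)
  (fun _ _ q => Distr (law0 q) (law1 q)).
have ans w h q b : answer_prob eps cs (tau w) h q b = law q b.
  rewrite /answer_prob /=; case: ifP => // qT.
  rewrite /law /truth; case: w qT => /= [-> //|qT].
  by rewrite (negbTE (dab _ qT)).
exists cs; split; first by apply: push_places => -[].
move=> pl; rewrite success_push big_bool /om /= -mulrDr.
rewrite -[leRHS]mulr1 ler_wpM2l //.
rewrite -/cs (event_prob_eq_answers eps cs pl _ Tb Ta); last first.
  by move=> h q b; rewrite (ans false) (ans true).
apply: event_prob_disjoint => // T' ha; apply/negP => hb.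
(* An output close to both sides would force [2 t <= n / 5], against [n < 10 t]. *)
have : (#|symdiff Ta Tb| <= #|symdiff Ta T'| + #|symdiff Tb T'|)%N.
  exact: card_symdiff_triangle.
rewrite (_ : #|symdiff Ta Tb| = (t + t)%N); last first.
  rewrite -{1}Tat -Tbt -cardsUI (_ : Ta :&: Tb = finset.set0).
    rewrite cards0 addn0; apply: eq_card => x; rewrite !finset.inE.
    by have := dab x; case: (x \in Ta); case: (x \in Tb) => // /(_ isT).
  apply/setP => x; rewrite !finset.inE; have := dab x.
  by case: (x \in Ta); case: (x \in Tb) => // /(_ isT).
rewrite -(ler_nat R) !natrD.
have : #|V|%:R + 1 <= 10 * t%:R :> R by rewrite natr1 -natrM ler_nat.
by move: ha hb; lra.
Qed.

End SuccessBounds.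

(** * A fair mixture of a world and the complement of a slightly smaller one *)

Section TwoWorlds.
Context {R : realType} {V : finType} {e : rel V}.
Variables (eps : R) (heps : 0 < eps < 1).
Variables (I : finType) (iota : I -> V) (G : {set V}).
Hypotheses (iota_inj : injective iota)
  (iota_indep : forall i i', ~~ e (iota i) (iota i'))
  (iotaG : forall i, iota i \notin G).
Variables (rho : R).
Hypotheses (rho0 : 0 <= rho) (rho1 : expR (- rho) * (1 - eps) <= eps)
  (rho2 : expR (- rho) * eps <= 1 - eps).
Variables (s Q t : nat) (A L : R).
Hypotheses (s0 : (0 < s)%N) (hs : (8 * s ^ 2 <= #|I|)%N) (A0 : 0 <= A)
  (hL : 2 * (#|I|%:R + 1) <= L) (hI : (5 * #|I| < 4 * #|V|)%N).
Hypotheses (ht1 : (#|G| + #|I|./2 = t)%N)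
  (ht2 : (t + (#|G| + (#|I|./2 - s)) = #|V|)%N).

Let F : {set V} := [set iota i | i in [set: I]].
Let J := #|I|./2.
Let world := world I iota G.

(* The parts of the two events outside of F do not depend on S. *)
Let near (X : {set V}) : pred {set V} :=
  fun T' => (10 * #|symdiff X T' :\: F| <= #|V|)%N.

Let cardF : #|F| = #|I|.
Proof. by rewrite card_imset // cardsT. Qed.

Let world_out S v : v \notin F -> (v \in world S) = (v \in G).
Proof.
move=> vF; apply: in_world_out => i; apply: contraNneq vF => ->.
by apply: imset_f; rewrite finset.in_setT.
Qed.

Let near_world (X T' : {set V}) (Y : {set V}) :
  (forall v, v \notin F -> (v \in X) = (v \in Y)) ->
  #|symdiff X T'|%:R <= #|V|%:R / 10 :> R -> near Y T'.
Proof.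
move=> XY h; have h' : (10 * #|symdiff X T'| <= #|V|)%N.
  by rewrite -(ler_nat R) natrM; lra.
apply: leq_trans h'; rewrite leq_mul2l /=.
apply: subset_leq_card; apply/fintype.subsetP => v.
rewrite !finset.inE => /andP[vF].
by rewrite -(XY v) //.
Qed.

(** Every vertex outside F lies in one of the two symmetric differences, so both being small would
    give [n - #|I| <= n / 5]. *)
Let near_disjoint T' : near G T' -> ~~ near (~: G) T'.
Proof.
rewrite /near => h1; apply/negP => h2.
have h3 : (#|~: F| <= #|symdiff G T' :\: F| + #|symdiff (~: G) T' :\: F|)%N.
  apply: leq_trans (leq_card_setU _ _); apply/subset_leq_card/fintype.subsetP => x.
  by rewrite !finset.inE; case: (x \in F); case: (x \in G); case: (x \in T').
by have := cardsC F; rewrite cardF; lia.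
Qed.

Lemma success_two_worlds : exists cs : corrupt_strategy R e,
  places_truthful cs t /\ forall pl : player R e,
  success_prob eps Q cs pl <= 1 / 2 +
    s%:R * (step_factor I rho Q * (3 * A + tail_factor A * L)).
Proof.
have sJ : (s <= J)%N by rewrite /J; nia.
have I0 : (0 < #|I|)%N by nia.
pose size_of (w : bool) := if w then J else (J - s)%N.
have C0 w : 0 < 'C(#|I|, size_of w)%:R :> R.
  by rewrite ltr0n bin_gt0 /size_of /J; case: w; lia.
(* A fair coin selects the world, and S is then uniform on the layer that makes the truthful set
   have size t. *)
pose om (w : bool * {set I}) : R :=
  if #|w.2| == size_of w.1 then (1 / 2) / 'C(#|I|, size_of w.1)%:R else 0.
pose tau (w : bool * {set I}) := if w.1 then world w.2 else ~: world w.2.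
have omE (f : bool -> {set I} -> R) : \sum_w om w * f w.1 w.2 =
    1 / 2 * layer_avg J (f true) + 1 / 2 * layer_avg (J - s) (f false).
  rewrite -(pair_big xpredT xpredT (fun b S => om (b, S) * f b S)) /= big_bool /=.
  have half b : \sum_S om (b, S) * f b S =
      1 / 2 * layer_avg (size_of b) (f b).
    rewrite /layer_avg mulrA mulrAC mulr_sumr [RHS]big_mkcond /=.
    by apply: eq_bigr => S _; rewrite /om /=; case: ifP => _; rewrite ?mul0r.
  by rewrite !half.
have om0 w : 0 <= om w by rewrite /om; case: ifP => // _; rewrite divr_ge0.
have om1 : \sum_w om w = 1.
  have := omE (fun _ _ => 1); under eq_bigr do rewrite mulr1.
  move=> ->; rewrite /layer_avg !layer_sum1 !divff ?gt_eqF ?(C0 true) ?(C0 false) //.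
  by lra.
pose P := push_distr om tau om0 om1.
exists (mutual_strategy eps heps P); split.
  apply: push_places => -[w S]; rewrite /om /tau /=.
  case: ifP => [/eqP Sw _|_]; last by rewrite eqxx.
  have cw := card_world I iota G iota_inj iotaG S; rewrite Sw in cw.
  rewrite /size_of in cw; case: w {Sw} cw => cw; first by rewrite cw.
  by have := cardsC (world S); rewrite [X in (X + _)%N]cw; lia.
move=> pl; rewrite success_push.
pose x E := world_event_prob eps heps I iota G Q P pl E.
pose f (b : bool) := if b then x (near G) else x (near (~: G)).
apply: (@le_trans _ _ (\sum_w om w * f w.1 w.2)).
  apply: ler_sum => -[w S] _; rewrite ler_wpM2l //; rewrite /tau /f /=.
  case: w; rewrite /x /world_event_prob.
    by apply: event_prob_sub => // T'; apply: near_world => v; apply: world_out.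
  rewrite (event_prob_eq_answers _ _ _ _ (~: world S) (world S)).
    apply: event_prob_sub => // T'; apply: near_world => v vF.
    by rewrite !finset.in_setC world_out.
  by move=> h q b; rewrite !mutual_answer mutual_lawC.
rewrite omE /f.
(* Outputs near [~: G] are transferred from layer [J - s] to layer J, where they compete with
   outputs near G for total probability 1. *)
have cl := event_avg_close eps heps I iota G iota_inj iota_indep iotaG rho
  rho1 rho2 rho0 I0 Q A A0 P pl (near (~: G)) s L s0 hs sJ hL.
have sum1 : layer_avg J (x (near G)) + layer_avg J (x (near (~: G))) <= 1.
  rewrite /layer_avg -mulrDl ler_pdivrMr ?(C0 true) // mul1r.
  rewrite -layer_sum1 /layer_sum -big_split /=.
  apply: ler_sum => S _; exact: event_prob_disjoint.
move: cl; rewrite ler_norml -/(x (near (~: G))) -/J => /andP[cl _].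
by move: cl sum1; set u := step_factor _ _ _; nra.
Qed.

End TwoWorlds.

(** * Sizes and quantitative bound for a truthful majority *)

Lemma majority_sizes (n f t b : nat) : let m := uphalf f in
  (t + b)%N = n -> (b < t)%N -> (f <= n)%N -> (8 * (t - b) <= m)%N ->
  [/\ (t - m./2 <= n - m)%N, (m < n)%N, (5 * m < 4 * n)%N,
     (t - m./2 + m./2 = t)%N & (t + (t - m./2 + (m./2 - (t - b))) = n)%N].
Proof.
move=> m tb bt fn s8.
have m1 : (2 * m <= n + 1)%N by rewrite /m; lia.
have : (2 * m./2 <= m)%N by lia.
have : (m <= 2 * m./2 + 1)%N by lia.
move: (m./2) m1 s8 => h; move: m => m.
by clear -tb bt; move=> *; split; lia.
Qed.

Section Majority.
Context {R : realType} {V : finType} {e : rel V}.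
Variables (eps : R) (heps : 0 < eps < 1).

Lemma log_odds_bound : exists2 rho : R, 0 <= rho &
  expR (- rho) * (1 - eps) <= eps /\ expR (- rho) * eps <= 1 - eps.
Proof.
have /andP[e0 e1] := heps; have e1' : 0 < 1 - eps by lra.
set x := (1 - eps) / eps; have x0 : 0 < x by apply: divr_gt0.
(* This is the largest change of log-odds from one answer; the absolute value covers
   [eps > 1 / 2]. *)
exists `|ln x| => //; split.
  rewrite -ler_pdivlMr // -[eps / _]invf_div -/x -{2}(lnK x0) -expRN ler_expR.
  by rewrite lerN2 ler_norm.
rewrite -ler_pdivlMr // -/x -{2}(lnK x0) ler_expR.
by have := ler_norm (- ln x); rewrite normrN; lra.
Qed.

Lemma success_majority (rho : R) (d t b Q : nat) :
  0 <= rho -> expR (- rho) * (1 - eps) <= eps -> expR (- rho) * eps <= 1 - eps ->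
  simple_graph e -> max_degree_le e d -> (t + b)%N = #|V| -> (b < t)%N ->
  (8 * (t - b) ^ 2 * (2 * d.+1) <= #|V|)%N ->
  let n : R := #|V|%:R in let D : R := (2 * d.+1)%:R in
  exists cs : corrupt_strategy R e, places_truthful cs t /\
    forall pl : player R e, success_prob eps Q cs pl <= 1 / 2 +
      (t - b)%:R * (8 * Num.sqrt (D / n) * expR (rho * (D * (Q%:R / n))) *
        (3 * ln n + 8 * expR 1)).
Proof.
move=> rho0 rho1 rho2 simple deg tb bt hs n D.
have [F0 F0in F0n] := independent_set d simple deg.
(* Half of the independent set still has linear size, and leaves more than [n / 5] vertices
   outside. *)
have [F FF0 Fm] : exists2 F : {set V}, F \subset F0 & #|F| = uphalf #|F0|.
  by apply: subset_of_card; lia.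
have F0le : (#|F0| <= #|V|)%N by apply: max_card.
pose I : finType := {x | x \in F}.
have IF : #|{: I}| = #|F| by rewrite card_sig; apply: eq_card => x; rewrite inE.
set m := #|F| in Fm IF.
have nDm : (#|V| <= 2 * d.+1 * m)%N by nia.
set s := (t - b)%N in hs *; have s0 : (0 < s)%N by rewrite /s; lia.
have hsm : (8 * s ^ 2 <= m)%N.
  by rewrite -(@leq_pmul2r (2 * d.+1)) //; apply: leq_trans hs _; rewrite mulnC.
have s8 : (8 * s <= m)%N by apply: leq_trans hsm; nia.
have [hGF mn hI' ht1' ht2'] : [/\ (t - m./2 <= #|V| - m)%N, (m < #|V|)%N,
    (5 * m < 4 * #|V|)%N, (t - m./2 + m./2 = t)%N &
    (t + (t - m./2 + (m./2 - s)) = #|V|)%N].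
  by move: s8; rewrite /s Fm; apply: majority_sizes.
have m0 : (0 < m)%N by apply: leq_trans s8; rewrite muln_gt0.
have [G GF Gt] : exists2 G : {set V}, G \subset ~: F & #|G| = (t - m./2)%N.
  by apply: subset_of_card; apply: leq_trans hGF _; rewrite -(cardsC F) addKn.
have n1 : 1 <= n by rewrite ler1n; apply: leq_ltn_trans mn.
have n0 : 0 < n by lra.
have mR : 0 < m%:R :> R by rewrite ltr0n.
have indep (i i' : I) : ~~ e (val i) (val i').
  by apply: F0in; apply: (fintype.subsetP FF0); apply: valP.
have iG (i : I) : val i \notin G.
  apply/negP => /(fintype.subsetP GF); rewrite finset.in_setC => /negP; apply.
  exact: valP.
have hL : 2 * (#|I|%:R + 1) <= 2 * n :> R.
  by rewrite ler_wpM2l // IF natr1 ler_nat.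
have hsI : (8 * s ^ 2 <= #|I|)%N by rewrite IF.
have hI : (5 * #|I| < 4 * #|V|)%N by rewrite IF.
have ht1 : (#|G| + #|I|./2 = t)%N by rewrite IF Gt.
have ht2 : (t + (#|G| + (#|I|./2 - s)) = #|V|)%N by rewrite IF Gt.
(* With [A = ln n] the tail is of order [1 / n], which absorbs [L = 2 * n] and leaves the constant
   [8 * expR 1]. *)
have [cs [cst hcs]] := success_two_worlds eps heps I val G val_inj indep iG rho
  rho0 rho1 rho2 s Q t (ln n) (2 * n) s0 hsI (ln_ge0 n1) hL hI ht1 ht2.
exists cs; split => // pl; apply: le_trans (hcs pl) _.
rewrite lerD2l ler_wpM2l //.
have -> : tail_factor (ln n) * (2 * n) = 8 * expR 1.
  by rewrite /tail_factor expRN lnK ?posrE //; field; rewrite gt_eqF.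
apply: ler_wpM2r.
  by rewrite addr_ge0 ?mulr_ge0 ?expR_ge0 ?ln_ge0.
have nDm' : n <= D * m%:R by rewrite -natrM ler_nat.
have D0 : 0 < D by rewrite ltr0n.
have mD : m%:R^-1 <= D / n.
  by rewrite ler_pdivlMr // mulrC ler_pdivrMr.
have sm : 0 < Num.sqrt m%:R :> R by rewrite sqrtr_gt0.
have -> : step_factor I rho Q = 8 * Num.sqrt (m%:R^-1) * expR (rho * (Q%:R / m%:R)).
  rewrite /step_factor /min_variance IF expRN sqrtrV ?(ltW mR) //.
  rewrite -[in LHS](sqr_sqrtr (ltW mR)) [in LHS]sqrtr_sqr (gtr0_norm sm).
  set E := expR _; set E' := expR _.
  have -> : E = E' by rewrite /E /E' sqr_sqrtr // ltW.
  have E0 : 0 < E' by apply: expR_gt0.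
  by field; rewrite !gt_eqF.
apply: ler_pM; rewrite ?mulr_ge0 ?sqrtr_ge0 ?expR_ge0 //.
  by rewrite ler_wpM2l // ler_wsqrtr.
rewrite ler_expR ler_wpM2l // mulrCA ler_wpM2l //.
Qed.

End Majority.

(** * Asymptotics in the number of vertices *)

Local Open Scope classical_set_scope.
Local Open Scope ring_scope.

Theorem theorem2p2 (R : realType) (eps beta : R) (d : nat) (Q : nat -> nat)
  (heps : 0 < eps < 1) (hbeta : 0 < beta)
  (hQ : (fun n : nat => (Q n)%:R : R^o) =o_\oo
        (fun n : nat => n%:R * ln n%:R : R^o)) :
  exists delta : nat -> R, delta @ \oo --> (0 : R) /\
    forall (V : finType) (e : rel V),
      simple_graph e -> connected_graph e -> max_degree_le e d ->
    forall t b : nat, (t + b)%N = #|V| ->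
      t%:R - b%:R <= #|V|%:R `^ (1 / 2 - beta) :> R ->
      #|V|%:R / 10 < t%:R :> R ->
    exists cs : corrupt_strategy R e,
      places_truthful cs t /\
      forall pl : player R e, at_most_queries pl (Q #|V|) ->
        success_prob eps (Q #|V|) cs pl <= 1 / 2 + delta #|V|.
Proof.
have [rho rho0 [rho1 rho2]] := log_odds_bound eps heps.
pose D : R := (2 * d.+1)%:R; have D0 : 0 < D by rewrite ltr0n.
(* With [Q n <= c * n * ln n] the factor [expR (rho * D * Q / n)] is at most [n ^ (beta / 4)]; the
   [+ 1] covers [rho = 0]. *)
pose c : R := beta / 4 / (rho * D + 1).
have rD0 : 0 <= rho * D by rewrite mulr_ge0 // ltW.
have rD : 0 < rho * D + 1 by lra.
have c0 : 0 < c by rewrite !divr_gt0.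
pose K : R := 8 * Num.sqrt D * (12 / beta + 8 * expR 1).
have K0 : 0 <= K.
  apply: mulr_ge0; first by rewrite mulr_ge0 ?sqrtr_ge0.
  by apply: addr_ge0; rewrite ?mulr_ge0 ?expR_ge0 ?invr_ge0 ?(ltW hbeta).
have KE : K = 8 * Num.sqrt D * (12 / beta + 8 * expR 1) by [].
clearbody K.
have /eqoP/(_ c c0) hQc := hQ.
(* The last condition says [8 * D <= n ^ (2 * beta)], which with [s ^ 2 <= n ^ (1 - 2 * beta)] gives
   the size hypothesis of [success_majority]. *)
have : \forall n \near \oo, [/\ (2 <= n)%N,
    (Q n)%:R <= c * (n%:R * ln n%:R) :> R &
    8 * D <= expR (2 * beta * ln n%:R) :> R].
  near=> n.
  have n2 : (2 <= n)%N by near: n; exists 2.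
  have n0 : 0 < n%:R :> R by rewrite ltr0n (leq_trans _ n2).
  have ln0 : 0 <= ln n%:R :> R by apply: ln_ge0; rewrite ler1n ltnW.
  split=> //.
    have : `|(Q n)%:R : R^o| <= c * `|n%:R * ln n%:R : R^o|.
      by near: n; exact: hQc.
    by rewrite !ger0_norm // mulr_ge0.
  have hn : expR (ln (8 * D) / (2 * beta)) <= n%:R by near: n; exact: nbhs_infty_ger.
  rewrite -[leLHS](@lnK _ (8 * D)) ?posrE ?mulr_gt0 // ler_expR.
  rewrite -ler_pdivrMl ?mulr_gt0 // mulrC -ler_expR lnK //.
move=> [N _ hN].
(* Below N the value 1 makes the bound trivial; from N on, this is [K * n ^ (- beta / 2)]. *)
exists (fun n => if (n < N)%N then 1 else K * expR (- (beta / 2 * ln n%:R))).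
split.
  apply/cvgr0Pnorm_le => eta eta0; near=> n.
  have nN : (N <= n)%N by near: n; exists N.
  have [n2 _ _] := hN n nN.
  have n0 : 0 < n%:R :> R by rewrite ltr0n (leq_trans _ n2).
  have Ke : 0 < (K + 1) / eta by rewrite divr_gt0 //; lra.
  rewrite ltnNge nN /= ger0_norm ?mulr_ge0 ?expR_ge0 //.
  have hn : expR (ln ((K + 1) / eta) / (beta / 2)) <= n%:R.
    by near: n; exact: nbhs_infty_ger.
  apply: (@le_trans _ _ (K * (eta / (K + 1)))).
    rewrite ler_wpM2l // expRN -[leRHS]invf_div.
    rewrite lef_pV2 ?posrE ?expR_gt0 // -[leLHS]lnK // ler_expR.
    by rewrite -ler_pdivrMl ?divr_gt0 // mulrC -ler_expR lnK.
  by rewrite mulrCA ler_piMr ?(ltW eta0) // ler_pdivrMr; lra.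
move=> V e simple _ deg t b tb ts Vt.
case: ifPn => [_|].
  have tV : (t <= #|V|)%N by rewrite -tb leq_addr.
  have [cs cst] := strategy_exists (R := R) (e := e) eps heps t tV.
  exists cs; split=> // pl _.
  by have := success_prob_le1 eps heps (Q #|V|) cs pl; lra.
rewrite -leqNgt => NV; have [n2 hQn hDn] := hN _ NV.
set n : R := #|V|%:R in ts hQn hDn *; set l := ln n in hQn hDn *.
have n0 : 0 < n by rewrite ltr0n (leq_trans _ n2).
have l0 : 0 <= l by apply: ln_ge0; rewrite ler1n ltnW.
have nE : n = expR l by rewrite lnK.
have [tleb|blt] := leqP t b.
  have [cs [cst hcs]] : exists cs : corrupt_strategy R e, places_truthful cs t /\
      forall pl : player R e, success_prob eps (Q #|V|) cs pl <= 1 / 2.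
    apply: success_minority => //; first by rewrite -tb leq_add2l.
    by rewrite -(ltr_nat R) natrM -/n; move: Vt; rewrite -/n; lra.
  exists cs; split=> // pl _; apply: le_trans (hcs pl) _.
  by rewrite lerDl mulr_ge0 ?expR_ge0.
pose s : R := (t - b)%:R.
have sE : s <= expR ((1 / 2 - beta) * l).
  by rewrite /s natrB 1?ltnW // (le_trans ts) // /powR gt_eqF.
have s0 : 0 <= s by [].
have hs : (8 * (t - b) ^ 2 * (2 * d.+1) <= #|V|)%N.
  rewrite -(ler_nat R) natrM -/D (natrM R 8) natrX -/s -/n.
  have s2 : s ^+ 2 <= expR ((1 - 2 * beta) * l).
    apply: (@le_trans _ _ (expR ((1 / 2 - beta) * l) ^+ 2)).
      by rewrite lerXn2r // nnegrE expR_ge0.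
    by rewrite expr2 -expRD ler_expR; lra.
  rewrite mulrAC nE.
  apply: (@le_trans _ _ (expR (2 * beta * l) * expR ((1 - 2 * beta) * l))).
    by apply: ler_pM; rewrite ?mulr_ge0 ?sqr_ge0 // ltW.
  by rewrite -expRD ler_expR; lra.
have [cs [cst hcs]] := success_majority eps heps rho d t b (Q #|V|) rho0 rho1
  rho2 simple deg tb blt hs.
exists cs; split=> // pl _; apply: le_trans (hcs pl) _.
rewrite lerD2l -/n -/D -/l -/s.
have sq : Num.sqrt (D / n) = Num.sqrt D * expR (- (l / 2)).
  rewrite sqrtrM ?(ltW D0) //; congr (_ * _).
  rewrite sqrtrV ?(ltW n0) // expRN; congr (_^-1).
  have -> : n = expR (l / 2) ^+ 2 by rewrite expr2 -expRD -splitr.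
  by rewrite sqrtr_sqr gtr0_norm ?expR_gt0.
have b1 : expR (rho * (D * ((Q #|V|)%:R / n))) <= expR (beta / 4 * l).
  rewrite ler_expR mulrA.
  apply: (@le_trans _ _ (rho * D * (c * l))).
    rewrite ler_wpM2l // ler_pdivrMr //.
    by apply: le_trans hQn _; rewrite [n * l]mulrC mulrA.
  rewrite mulrA ler_wpM2r // /c mulrCA ler_piMr ?divr_ge0 ?(ltW hbeta) //.
  by rewrite ler_pdivrMr // mul1r lerDl.
(* The logarithm is absorbed by a second factor [n ^ (beta / 4)], at the cost of the constant in
   K. *)
have b2 : 3 * l + 8 * expR 1 <= (12 / beta + 8 * expR 1) * expR (beta / 4 * l).
  have h1 : l <= 4 / beta * expR (beta / 4 * l).
    rewrite -ler_pdivrMl ?divr_gt0 // invf_div.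
    by have := expR_ge1Dx (beta / 4 * l); lra.
  have h2 : 1 <= expR (beta / 4 * l).
    by rewrite -expR0 ler_expR mulr_ge0 // divr_ge0 // ltW.
  rewrite (mulrDl (12 / beta)); apply: lerD; last by rewrite ler_peMr ?mulr_ge0 ?expR_ge0.
  have -> : 12 / beta = 3 * (4 / beta) by ring.
  by rewrite -mulrA ler_wpM2l.
rewrite sq; set E := expR (beta / 4 * l) in b1 b2.
apply: (@le_trans _ _ (expR ((1 / 2 - beta) * l) *
   (8 * (Num.sqrt D * expR (- (l / 2))) * E *
     ((12 / beta + 8 * expR 1) * E)))).
  have e1 : 0 <= 8 * (Num.sqrt D * expR (- (l / 2))).
    by rewrite !mulr_ge0 ?sqrtr_ge0 ?expR_ge0.
  have e2 : 0 <= 3 * l + 8 * expR 1.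
    by rewrite addr_ge0 ?mulr_ge0 ?expR_ge0.
  apply: ler_pM => //; first by rewrite !mulr_ge0 ?expR_ge0.
  by apply: ler_pM => //; apply: ler_wpM2l.
rewrite (_ : _ * _ = K * (expR ((1 / 2 - beta) * l) * expR (- (l / 2)) * E * E));
  last by rewrite KE; ring.
(* The exponents of n add up: [(1 / 2 - beta) - 1 / 2 + beta / 4 + beta / 4 = - beta / 2]. *)
rewrite ler_wpM2l // -!expRD ler_expR.
by lra.
Unshelve. all: by end_near.
Qed.
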